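(* Let $N_m(x)$ denote the $m$-th Narayana polynomial, defined by $N_0(x)=1$ and $$N_m(x)=\sum_{k=0}^{m}\frac{1}{m}\binom{m}{k}\binom{m}{k-1}x^k\qquad(m\geq 1).$$ Then for all integers $n\geq 0$ the following identity of polynomials in $x$ holds: $$\operatorname{Pf}\big((j-i)N_{i+j-2}(x)\big)_{1\leq i,j\leq 2n}=x^{n^2}\prod_{k=0}^{n-1}(4k+1).$$
   Context: For a $2n\times 2n$ skew-symmetric matrix $A=(a_{i,j})_{1\le i,j\le 2n}$ over a commutative ring (i.e. $a_{j,i}=-a_{i,j}$ and zero diagonal), the Pfaffian is $$\operatorname{Pf}(A)=\sum \epsilon(\sigma_1,\sigma_2,\dots,\sigma_{2n-1},\sigma_{2n})\,a_{\sigma_1\sigma_2}\cdots a_{\sigma_{2n-1}\sigma_{2n}},$$ where the sum is over all partitions $\{\{\sigma_1,\sigma_2\},\dots,\{\sigma_{2n-1},\sigma_{2n}\}\}$ of $\{1,\dots,2n\}$ into two-element subsets, and $\epsilon(\sigma_1,\dots,\sigma_{2n})$ is the sign of the permutation $i\mapsto\sigma_i$ (each summand is independent of the order of the blocks and of the elements within each block). The Pfaffian of the empty ($0\times 0$) matrix is $1$, empty products equal $1$, and $\binom{m}{-1}=0$. *)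

(* Defs.v *)
From HB Require Import structures.
From mathcomp Require Import all_boot all_order all_fingroup all_algebra.
Set Implicit Arguments.
Unset Strict Implicit.
Unset Printing Implicit Defensive.
Import GRing.Theory.
Local Open Scope ring_scope.

Lemma ord_fst_subproof n (i : 'I_n) : (i.*2 < n.*2)%N.
Proof. by rewrite ltn_double. Qed.

Lemma ord_snd_subproof n (i : 'I_n) : (i.*2.+1 < n.*2)%N.
Proof. by rewrite ltn_Sdouble. Qed.

Definition ord_fst n (i : 'I_n) : 'I_n.*2 := Ordinal (ord_fst_subproof i).
Definition ord_snd n (i : 'I_n) : 'I_n.*2 := Ordinal (ord_snd_subproof i).

Definition pair_partition n (P : {set {set 'I_n.*2}}) : bool :=
  partition P [set: 'I_n.*2] && [forall B in P, #|B| == 2].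

(* The sequence s 0, s 1, ..., s (2n - 1) lists the blocks one after the
   other: {s 0, s 1}, {s 2, s 3}, ... *)
Definition blocks n (s : 'S_n.*2) : {set {set 'I_n.*2}} :=
  [set [set s (ord_fst i); s (ord_snd i)] | i : 'I_n].

Definition pf_term (R : comNzRingType) n (A : 'M[R]_n.*2) (s : 'S_n.*2) : R :=
  (-1) ^+ s * \prod_(i < n) A (s (ord_fst i)) (s (ord_snd i)).

(* Each pair partition P contributes the term of one arbitrary listing s of
   its blocks; such an s always exists, and the term does not depend on its
   choice when A is skew-symmetric with zero diagonal.  The value is only
   meaningful for such A. *)
Definition pfaffian (R : comNzRingType) n (A : 'M[R]_n.*2) : R :=
  \sum_(P : {set {set 'I_n.*2}} | pair_partition P)
    (if [pick s : 'S_n.*2 | blocks s == P] is Some s then pf_term A s else 0).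

(* 'C(m, k - 1) with the convention 'C(m, -1) = 0; truncated subtraction
   would give 'C(m, 0) = 1 at k = 0. *)
Definition bin_pred (m k : nat) : nat := if k is k'.+1 then 'C(m, k') else 0%N.

Definition narayana (m : nat) : {poly rat} :=
  if m == 0%N then 1 else
  \sum_(0 <= k < m.+1)
    (m%:R^-1 * ('C(m, k))%:R * (bin_pred m k)%:R : rat) *: 'X^k.

(* Indices are 0-based: with (i, j) standing for the 1-based pair
   (i + 1, j + 1), the difference j - i is unchanged and the degree
   (i + 1) + (j + 1) - 2 is i + j. *)
Definition narayana_mx (n : nat) : 'M[{poly rat}]_n.*2 :=
  \matrix_(i, j) ((j%:R - i%:R) * narayana (i + j)).

(* Main.v *)
(* Let M be the linear functional on Q[x][t] with M(t^m) = N_{m+1}(x) / x.  Up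
   to the factor x, the matrix is the Gram matrix of the alternating form
   W(f, g) = M(f g' - f' g) in the basis of the powers of t.  M is the moment
   functional of the semicircle law with mean 1 + x and variance x, so its monic
   orthogonal polynomials are rescaled Chebyshev polynomials of the second kind,
   U_{n+2} = (t - (1 + x)) U_{n+1} - x U_n, and M(U_i U_j) = x^i if i = j, and 0
   otherwise.  The first-kind polynomials T_n = U_n - x U_{n-2} have derivative
   n U_{n-1}.  In the unitriangular basis U_0, T_1, U_2, T_3, ... the form
   vanishes between indices of equal parity, W(U_{2i}, T_{2j+1}) = 0 for i < j,
   and W(U_{2i}, T_{2i+1}) = (4i + 1) x^{2i}.  Hence a single matching
   contributes to the Pfaffian in that basis. *)
Require Import Defs.
From HB Require Import structures.
From mathcomp Require Import all_boot all_order all_fingroup all_algebra.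
From mathcomp Require Import ring lra zify.
Set Implicit Arguments.
Unset Strict Implicit.
Unset Printing Implicit Defensive.
Import GRing.Theory Num.Theory.
Local Open Scope ring_scope.

(** * Sums over all permutations and Pfaffians *)

Lemma ord_half_subproof n (k : 'I_n.*2) : (k./2 < n)%N.
Proof. by rewrite ltn_half_double. Qed.

Definition ord_half n (k : 'I_n.*2) : 'I_n := Ordinal (ord_half_subproof k).

Lemma ord_half_fst n (i : 'I_n) : ord_half (ord_fst i) = i.
Proof. by apply: val_inj; rewrite /= doubleK. Qed.

Lemma ord_half_snd n (i : 'I_n) : ord_half (ord_snd i) = i.
Proof. by apply: val_inj; rewrite /= uphalf_double. Qed.

Lemma odd_ord_fst n (i : 'I_n) : odd (ord_fst i) = false.
Proof. by rewrite /= odd_double. Qed.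

Lemma odd_ord_snd n (i : 'I_n) : odd (ord_snd i) = true.
Proof. by rewrite /= odd_double. Qed.

Lemma ord_half_inj n (k l : 'I_n.*2) :
  odd k = odd l -> ord_half k = ord_half l -> k = l.
Proof.
move=> o /(congr1 val) /= h; apply: val_inj.
by rewrite /= -[k : nat]odd_double_half -[l : nat]odd_double_half o h.
Qed.

Variant ord_double_spec n : 'I_n.*2 -> Type :=
  | OrdFst i : ord_double_spec (ord_fst i)
  | OrdSnd i : ord_double_spec (ord_snd i).

Lemma ord_doubleP n (k : 'I_n.*2) : ord_double_spec k.
Proof.
case ok: (odd k).
  rewrite (_ : k = ord_snd (ord_half k)); first by constructor.
  by apply: ord_half_inj; rewrite ?odd_ord_snd ?ord_half_snd.
rewrite (_ : k = ord_fst (ord_half k)); first by constructor.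
by apply: ord_half_inj; rewrite ?odd_ord_fst ?ord_half_fst.
Qed.

Lemma ord_fst_inj n : injective (@ord_fst n).
Proof. exact: can_inj (@ord_half_fst n). Qed.

Lemma ord_snd_inj n : injective (@ord_snd n).
Proof. exact: can_inj (@ord_half_snd n). Qed.

Lemma ord_fst_snd n (i j : 'I_n) : (ord_fst i == ord_snd j) = false.
Proof.
apply/eqP => /(congr1 (fun k => odd (nat_of_ord k))).
by rewrite odd_ord_fst odd_ord_snd.
Qed.

Lemma ord_snd_fst n (i j : 'I_n) : (ord_snd i == ord_fst j) = false.
Proof. by rewrite eq_sym ord_fst_snd. Qed.

Lemma big_ord_double (T : Type) (idx : T) (op : Monoid.com_law idx) n
    (F : 'I_n.*2 -> T) :
  \big[op/idx]_k F k = \big[op/idx]_(i < n) op (F (ord_fst i)) (F (ord_snd i)).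
Proof.
rewrite (partition_big (@ord_half n) xpredT) //=; apply: eq_bigr => i _.
rewrite (bigD1 (ord_fst i)) /= ?ord_half_fst //.
rewrite (bigD1 (ord_snd i)) /= ?ord_half_snd ?eqxx ?ord_snd_fst //.
rewrite big1 ?Monoid.mulm1 // => k /andP[/andP[/eqP <-]].
case: (ord_doubleP k) => j; first by rewrite ord_half_fst eqxx.
by rewrite ord_half_snd eqxx.
Qed.

(** The two images of a block share a half and are distinct, so they have opposite parities and fill
    their target block. Injectivity of [s] then keeps every other block out of it. *)
Lemma ord_half_perm_eq n (s : 'S_n.*2) (k l : 'I_n.*2) :
    (forall i, ord_half (s (ord_fst i)) = ord_half (s (ord_snd i))) ->
  (ord_half (s k) == ord_half (s l)) = (ord_half k == ord_half l).
Proof.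
move=> hs.
have hsE j : ord_half (s j) = ord_half (s (ord_fst (ord_half j))).
  by case: (ord_doubleP j) => i; rewrite ?ord_half_fst ?ord_half_snd -?hs.
apply/eqP/eqP => [|h]; last by rewrite hsE h -hsE.
rewrite hsE (hsE l); move: (ord_half k) (ord_half l) => i j h.
have oi : odd (s (ord_snd i)) = ~~ odd (s (ord_fst i)).
  case e1: (odd (s (ord_snd i))); case e2: (odd (s (ord_fst i))) => //;
  have /perm_inj/eqP := ord_half_inj (etrans e2 (esym e1)) (hs i);
  by rewrite ord_fst_snd.
case: (odd (s (ord_fst i)) =P odd (s (ord_fst j))) => [o | o].
  by have /perm_inj/ord_fst_inj := ord_half_inj o h.
have o' : odd (s (ord_snd i)) = odd (s (ord_fst j)).
  by rewrite oi; case: (odd (s (ord_fst i))) (odd (s (ord_fst j))) o => [] [].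
rewrite hs in h; have /perm_inj/eqP := ord_half_inj o' h.
by rewrite ord_snd_fst.
Qed.

(** * Pair partitions listed by permutations *)

Lemma mem_block n (i : 'I_n) (k : 'I_n.*2) :
  (k \in [set ord_fst i; ord_snd i]) = (ord_half k == i).
Proof.
rewrite !inE; case: (ord_doubleP k) => j.
  by rewrite ord_half_fst ord_fst_snd orbF (inj_eq (@ord_fst_inj n)).
by rewrite ord_half_snd ord_snd_fst (inj_eq (@ord_snd_inj n)).
Qed.

Lemma blocks_pair_partition n (s : 'S_n.*2) : pair_partition (blocks s).
Proof.
have memb i k : (k \in [set s (ord_fst i); s (ord_snd i)])
                = (ord_half ((s^-1)%g k) == i).
  by rewrite -mem_block !inE -[k in LHS](permKV s) !(inj_eq perm_inj).
apply/andP; split; last first.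
  apply/forallP => B; apply/implyP => /imsetP[i _ ->].
  by rewrite cards2 (inj_eq perm_inj) ord_fst_snd.
apply/and3P; split.
- apply/eqP/setP => k; rewrite inE; apply/bigcupP.
  exists [set s (ord_fst (ord_half ((s^-1)%g k)));
              s (ord_snd (ord_half ((s^-1)%g k)))]; first exact: imset_f.
  by rewrite memb.
- apply/trivIsetP => A B /imsetP[i _ ->] /imsetP[j _ ->] nij.
  rewrite -setI_eq0; apply/eqP/setP => k; rewrite in_setI !memb inE.
  apply/negP => /andP[/eqP hi /eqP hj].
  by rewrite -hi -hj eqxx in nij.
- apply/imsetP => -[i _ /setP /(_ (s (ord_fst i)))].
  by rewrite !inE eqxx.
Qed.

(** For the converse, [s] induces an injective map [f] on the [n] blocks; by finiteness [f] is onto,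
    so every standard block is hit. *)
Lemma blocks_eq1P n (s : 'S_n.*2) :
  reflect (forall i, ord_half (s (ord_fst i)) = ord_half (s (ord_snd i)))
          (blocks s == blocks 1).
Proof.
apply: (iffP eqP) => [/setP bs i | hs].
  have : [set s (ord_fst i); s (ord_snd i)] \in blocks 1.
    by rewrite -bs; apply/imsetP; exists i.
  case/imsetP => j _; rewrite !perm1 => /setP e.
  have := e (s (ord_fst i)); have := e (s (ord_snd i)).
  by rewrite !mem_block !inE !eqxx orbT /= => /esym/eqP-> /esym/eqP->.
have blockE i : [set s (ord_fst i); s (ord_snd i)] =
    [set ord_fst (ord_half (s (ord_fst i))); ord_snd (ord_half (s (ord_fst i)))].
  apply/setP=> k; rewrite mem_block -[k](permKV s) !inE.
  by rewrite !(inj_eq perm_inj) ord_half_perm_eq // ord_half_fst -mem_block !inE.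
pose f i := ord_half (s (ord_fst i)).
have fI : injective f.
  by move=> i j /eqP; rewrite ord_half_perm_eq // !ord_half_fst => /eqP.
apply/setP => B; apply/imsetP/imsetP => -[i _ ->].
  by exists (f i); rewrite ?perm1 -?blockE.
exists (invF fI i) => //; rewrite blockE !perm1.
by rewrite -/(f _) f_invF.
Qed.

(** In a product of permutations the left factor acts first, so a right factor relabels the points
    of each block. *)
Lemma blocksM n (s t : 'S_n.*2) :
  blocks (s * t) = [set t @: (B : {set _}) | B in blocks s].
Proof.
rewrite -imset_comp; apply: eq_imset => i /=.
by rewrite imsetU !imset_set1 !permM.
Qed.

Lemma blocksMr n (s t u : 'S_n.*2) :
  (blocks (s * u) == blocks (t * u)) = (blocks s == blocks t).
Proof.
rewrite !blocksM; apply/eqP/eqP => [|-> //].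
exact/imset_inj/imset_inj/perm_inj.
Qed.

(** * Permutations that move whole blocks *)

Section DoublePerm.
Variable n : nat.
Implicit Types p q : 'S_n.

Definition double_fun p (k : 'I_n.*2) : 'I_n.*2 :=
  if odd k then ord_snd (p (ord_half k)) else ord_fst (p (ord_half k)).

Lemma double_fun_inj p : injective (double_fun p).
Proof.
apply: (@can_inj _ _ _ (double_fun p^-1)) => k.
case: (ord_doubleP k) => i.
  by rewrite /double_fun !odd_ord_fst !ord_half_fst permK.
by rewrite /double_fun !odd_ord_snd !ord_half_snd permK.
Qed.

Definition double_perm p : 'S_n.*2 := perm (@double_fun_inj p).

Lemma double_perm_fst p i : double_perm p (ord_fst i) = ord_fst (p i).
Proof. by rewrite permE /double_fun odd_ord_fst ord_half_fst. Qed.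

Lemma double_perm_snd p i : double_perm p (ord_snd i) = ord_snd (p i).
Proof. by rewrite permE /double_fun odd_ord_snd ord_half_snd. Qed.

(** Doubling is a group morphism that sends a transposition to a product of two transpositions. *)
Lemma odd_double_perm p : odd_perm (double_perm p) = false.
Proof.
have d1 : double_perm 1 = 1%g.
  apply/permP => k; case: (ord_doubleP k) => i;
  by rewrite ?double_perm_fst ?double_perm_snd !perm1.
have dM q r : double_perm (q * r) = (double_perm q * double_perm r)%g.
  by apply/permP => k; case: (ord_doubleP k) => i;
    rewrite permM ?double_perm_fst ?double_perm_snd permM.
have dt i j : double_perm (tperm i j) =
    (tperm (ord_fst i) (ord_fst j) * tperm (ord_snd i) (ord_snd j))%g.
  apply/permP => k; case: (ord_doubleP k) => l; rewrite permM.
    rewrite double_perm_fst (tpermD (x := ord_snd i)) ?ord_snd_fst.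
    - by rewrite -(inj_tperm _ _ _ (@ord_fst_inj n)).
    - by rewrite -(inj_tperm _ _ _ (@ord_fst_inj n)) ord_snd_fst.
    - by rewrite -(inj_tperm _ _ _ (@ord_fst_inj n)) ord_snd_fst.
  rewrite double_perm_snd (tpermD (z := ord_snd l)) ?ord_fst_snd //.
  by rewrite -(inj_tperm _ _ _ (@ord_snd_inj n)).
have [ts -> _] := prod_tpermP p.
elim: ts => [|[i j] ts IH]; first by rewrite big_nil d1 odd_perm1.
rewrite big_cons dM odd_permM IH addbF dt odd_permM !odd_tperm.
by rewrite (inj_eq (@ord_fst_inj n)) (inj_eq (@ord_snd_inj n)) addbb.
Qed.

End DoublePerm.

(** * The Pfaffian through the sum over all listings *)

Section PermutationSum.
Variable R : comNzRingType.

(** This sum counts each pair partition once per listing of its blocks. It involves no choice of a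
    listing, so it can be expanded like a determinant. *)
Definition pf_sum n (A : 'M[R]_n.*2) : R := \sum_s pf_term A s.

Section Skew.
Variables (n : nat) (A : 'M[R]_n.*2).
Hypothesis skA : forall k l, A l k = - A k l.

Lemma pf_term_flip i s :
  pf_term A (tperm (ord_fst i) (ord_snd i) * s) = pf_term A s.
Proof.
rewrite /pf_term odd_permM odd_tperm ord_fst_snd signr_addb mulN1r mulNr -mulrN.
congr (_ * _); rewrite (bigD1 i) // [in RHS](bigD1 i) //= !permM tpermL tpermR.
rewrite skA mulNr opprK; congr (_ * _); apply: eq_bigr => j ji.
rewrite !permM !tpermD ?ord_fst_snd ?ord_snd_fst //.
  by rewrite (inj_eq (@ord_snd_inj n)) eq_sym.
by rewrite (inj_eq (@ord_fst_inj n)) eq_sym.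
Qed.

Lemma pf_term_double p s : pf_term A (double_perm p * s) = pf_term A s.
Proof.
rewrite /pf_term odd_permM odd_double_perm; congr (_ * _).
rewrite [RHS](reindex_inj (@perm_inj _ p)) /=; apply: eq_bigr => i _.
by rewrite !permM double_perm_fst double_perm_snd.
Qed.

(** The stabiliser of the standard partition is generated by the flips inside a block and the
    permutations of whole blocks, and both preserve the term. The induction is on the number of
    blocks that [s] reverses. *)
Lemma pf_term_stab s t : blocks s == blocks 1 -> pf_term A (s * t) = pf_term A t.
Proof.
have [m] := ubnP #|[pred i | odd (s (ord_fst i))]|.
elim: m s => // m IH s lem /blocks_eq1P hs.
have [i oi | ev] := pickP [pred i | odd (s (ord_fst i))].
  pose f := tperm (ord_fst i) (ord_snd i).
  have fj j : j != i -> (f * s)%g (ord_fst j) = s (ord_fst j)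
                     /\ (f * s)%g (ord_snd j) = s (ord_snd j).
    move=> ji; rewrite !permM !tpermD ?ord_fst_snd ?ord_snd_fst //.
      by rewrite (inj_eq (@ord_snd_inj n)) eq_sym.
    by rewrite (inj_eq (@ord_fst_inj n)) eq_sym.
  have fi : (f * s)%g (ord_fst i) = s (ord_snd i)
         /\ (f * s)%g (ord_snd i) = s (ord_fst i).
    by rewrite !permM tpermL tpermR.
  (* Flipping a reversed block [i] straightens it and leaves the other blocks alone, so the count
     drops. *)
  rewrite -(pf_term_flip i (s * t)) mulgA; apply: IH; last first.
    apply/blocks_eq1P => j; case: (eqVneq j i) => [-> | /fj[-> ->] //].
    by case: fi => -> ->.
  rewrite -ltnS; apply: leq_trans lem; rewrite ltnS.
  apply: proper_card; apply/properP; split.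
    apply/subsetP => j; rewrite !inE; case: (eqVneq j i) => [-> // | /fj[-> _] //].
  exists i => //; rewrite !inE (proj1 fi); apply/negP => o.
  have o' : odd (s (ord_fst i)) = odd (s (ord_snd i)) by rewrite o; exact: oi.
  by have /perm_inj/eqP := ord_half_inj o' (hs i); rewrite ord_fst_snd.
(* No block is reversed any more: [s] is the doubling of the permutation it induces on blocks. *)
have fI : injective (fun i => ord_half (s (ord_fst i))).
  by move=> i j /eqP; rewrite ord_half_perm_eq // !ord_half_fst => /eqP.
rewrite (_ : s = double_perm (perm fI)) ?pf_term_double //.
have evf i : odd (s (ord_fst i)) = false by have := ev i.
apply/permP => k; apply: ord_half_inj; case: (ord_doubleP k) => i.
- by rewrite double_perm_fst odd_ord_fst evf.
- rewrite double_perm_snd odd_ord_snd; case o: (odd (s (ord_snd i))) => //.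
  have o' : odd (s (ord_fst i)) = odd (s (ord_snd i)) by rewrite evf o.
  by have /perm_inj/eqP := ord_half_inj o' (hs i); rewrite ord_fst_snd.
- by rewrite double_perm_fst ord_half_fst permE.
- by rewrite double_perm_snd ord_half_snd permE hs.
Qed.

Lemma pf_term_blocks s t : blocks s = blocks t -> pf_term A s = pf_term A t.
Proof.
move=> st; rewrite -(mulgKV t s); apply: pf_term_stab.
by rewrite -(blocksMr _ _ t) mulgKV mul1g st.
Qed.

(** Terms are constant on the fibres of [blocks]. Each nonempty fibre is a coset of the stabiliser
    of the standard partition, hence has its cardinality. *)
Lemma pf_sum_pfaffian :
  pf_sum A = pfaffian A *+ #|[pred s : 'S_n.*2 | blocks s == blocks 1]|.
Proof.
rewrite /pf_sum /pfaffian (partition_big (@blocks n) (@pair_partition n)) /=;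
  last by move=> s _; exact: blocks_pair_partition.
rewrite -sumrMnl; apply: eq_bigr => P _; case: pickP => [t /= /eqP tP | noP].
  rewrite (eq_bigr (fun=> pf_term A t)) => [|s /eqP sP]; last first.
    by apply: pf_term_blocks; rewrite sP.
  rewrite sumr_const; congr (_ *+ _).
  rewrite -[RHS](card_imset _ (@mulIg _ t)); apply: eq_card => s.
  apply/idP/imsetP => [sP | [u uB ->]].
    have stP : blocks s == blocks t by rewrite tP; exact: sP.
    exists (s * t^-1)%g; last by rewrite mulgKV.
    suff : blocks (s * t^-1) == blocks 1 by [].
    by rewrite -(blocksMr _ _ t) mulgKV mul1g.
  suff : blocks (u * t) == P by [].
  by rewrite -tP -[X in _ == blocks X]mul1g blocksMr; exact: uB.
(* If no listing gave [P], the default value [0] would match an empty sum. *)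
by rewrite mul0rn big1 // => s; rewrite noP.
Qed.

End Skew.

(** As for the multiplicativity of determinants: expanding the entries of the product gives a sum
    over index functions [f], and for fixed [f] the signed sum over [s] is a determinant made of
    columns of [B]. *)
Lemma pf_sum_congr n (A B : 'M[R]_n.*2) :
  pf_sum (B *m A *m B^T) = \det B * pf_sum A.
Proof.
pose F := {ffun 'I_n.*2 -> 'I_n.*2}.
pose AA (f : F) := \prod_(i < n) A (f (ord_fst i)) (f (ord_snd i)).
transitivity (\sum_(f : F) AA f * \det (\matrix_(k, l) B l (f k))).
  under [RHS]eq_bigr => f _ do rewrite mulr_sumr.
  rewrite exchange_big; apply: eq_bigr => /= s _.
  under [RHS]eq_bigr => f _ do rewrite mulrCA.
  rewrite -mulr_sumr; congr (_ * _).
  pose G i (kl : 'I_n.*2 * 'I_n.*2) :=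
    A kl.1 kl.2 * (B (s (ord_fst i)) kl.1 * B (s (ord_snd i)) kl.2).
  transitivity (\prod_(i < n) \sum_kl G i kl).
    apply: eq_bigr => i _; rewrite mxE /G -(pair_bigA _ (fun k l => A k l *
      (B (s (ord_fst i)) k * B (s (ord_snd i)) l))) /=.
    rewrite exchange_big; apply: eq_bigr => l _; rewrite !mxE mulr_suml.
    by apply: eq_bigr => k _; ring.
  rewrite bigA_distr_bigA.
  (* A function on the [2n] indices amounts to [n] pairs of values, one for each block. *)
  pose h (f : F) := [ffun i => (f (ord_fst i), f (ord_snd i))].
  pose h' (g : {ffun 'I_n -> 'I_n.*2 * 'I_n.*2}) : F :=
    [ffun k => if odd (val k) then (g (ord_half k)).2 else (g (ord_half k)).1].
  rewrite (reindex h) /=; last first.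
    exists h' => [f _ | g _]; apply/ffunP => k; rewrite !ffunE.
      by case: (ord_doubleP k) => i;
        rewrite ?odd_ord_fst ?odd_ord_snd ?ord_half_fst ?ord_half_snd.
    by rewrite odd_ord_fst odd_ord_snd ord_half_fst ord_half_snd; case: (g k).
  apply: eq_bigr => f _; rewrite big_split /=; congr (_ * _).
    by apply: eq_bigr => i _; rewrite ffunE.
  by rewrite big_ord_double; apply: eq_bigr => i _; rewrite !mxE ffunE.
(* A non-injective [f] repeats a row, so its determinant is zero. An injective [f] is a permutation,
   which contributes its sign times [\det B]. *)
rewrite (bigID (fun f : F => injectiveb f)) /= addrC big1 ?add0r => [|f Uf].
  rewrite (reindex (@pval _)) /=; last first.
    pose in_Sn := insubd (1%g : 'S_n.*2).
    exists in_Sn => f Uf; [exact: valKd | exact: (insubdK (1%g : 'S_n.*2) Uf)].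
  rewrite mulr_sumr; apply: eq_big => /= [t | t _]; first by rewrite (valP t).
  rewrite (_ : \matrix_(_, _) _ = row_perm t B^T); last first.
    by apply/matrixP => k l; rewrite !mxE pvalE.
  have -> : AA (pval t) = \prod_(i < n) A (t (ord_fst i)) (t (ord_snd i)).
    by apply: eq_bigr => i _; rewrite pvalE.
  rewrite row_permE det_mulmx det_perm det_tr /pf_term.
  by rewrite mulrA mulrC [_ * _ ^+ _]mulrC.
have /injectivePn[k [l kl fkl]] := Uf.
by rewrite (determinant_alternate kl) ?mulr0 // => j; rewrite !mxE fkl.
Qed.

(** Only listings of the standard partition give a nonzero term, and by skewness these terms all
    agree. *)
Lemma pf_sum_triangular n (A : 'M[R]_n.*2) :
    (forall k l, A l k = - A k l) ->
    (forall k l : 'I_n.*2, odd k = odd l -> A k l = 0) ->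
    (forall i j : 'I_n, (i < j)%N -> A (ord_fst i) (ord_snd j) = 0) ->
  pf_sum A = (\prod_(i < n) A (ord_fst i) (ord_snd i))
             *+ #|[pred s : 'S_n.*2 | blocks s == blocks 1]|.
Proof.
move=> skA par tri.
rewrite /pf_sum (bigID (fun s => blocks s == blocks 1)) /= addrC big1 ?add0r.
  rewrite (eq_bigr (fun=> pf_term A 1)) => [|s /eqP]; last exact: pf_term_blocks.
  rewrite sumr_const; congr (_ *+ _); rewrite /pf_term odd_perm1 mul1r.
  by apply: eq_bigr => i _; rewrite !perm1.
move=> s nbs; rewrite /pf_term.
suff [i /eqP Ai] : exists i, A (s (ord_fst i)) (s (ord_snd i)) == 0.
  by rewrite (bigD1 i) //= Ai mul0r mulr0.
apply/existsP; apply: contraNT nbs; rewrite negb_exists => /forallP nz.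
(* A nonzero entry pairs [2a] with [2b + 1] for some [b <= a]; the weights
   [a - b] are then nonnegative and sum to zero, which forces [a = b]. *)
pose w (k : 'I_n.*2) : int := if odd k then - (k./2)%:Z else (k./2)%:Z.
have wS : \sum_k w (s k) = 0.
  transitivity (\sum_k w k); first by rewrite [RHS](reindex_perm s).
  rewrite big_ord_double big1 // => i _.
  by rewrite /w odd_ord_fst odd_ord_snd /= doubleK uphalf_double subrr.
have wi i : exists2 a : nat, w (s (ord_fst i)) + w (s (ord_snd i)) = a%:Z &
   (a = 0)%N -> ord_half (s (ord_fst i)) = ord_half (s (ord_snd i)).
  move: (nz i) => {nz}; rewrite /w.
  case: (ord_doubleP (s (ord_fst i))) => a;
    case: (ord_doubleP (s (ord_snd i))) => b;
    rewrite ?odd_ord_fst ?odd_ord_snd ?ord_half_fst ?ord_half_snd /=;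
    rewrite ?doubleK ?uphalf_double.
  - by rewrite par ?eqxx // !odd_ord_fst.
  - case: (ltnP a b) => [/tri->|ba _]; rewrite ?eqxx //.
    by exists (a - b)%N => [|ab]; [lia | apply: val_inj => /=; lia].
  - rewrite skA; case: (ltnP b a) => [/tri->|ba _]; rewrite ?oppr0 ?eqxx //.
    by exists (b - a)%N => [|ab]; [lia | apply: val_inj => /=; lia].
  - by rewrite par ?eqxx // !odd_ord_snd.
apply/blocks_eq1P => i; have [a aE] := wi i; apply.
rewrite big_ord_double in wS.
have w0 j : true -> 0 <= w (s (ord_fst j)) + w (s (ord_snd j)).
  by move=> _; have [b -> _] := wi j.
have /(_ i isT) := psumr_eq0P w0 wS; rewrite aE; lia.
Qed.

End PermutationSum.

(** * Moment functionals and shifted Chebyshev polynomials *)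

Section Moments.
Variables (R : comNzRingType) (mu : nat -> R).
Implicit Types f g : {poly R}.

Definition moment f : R := \sum_(i < size f) f`_i * mu i.

Lemma moment_widen n f : (size f <= n)%N -> moment f = \sum_(i < n) f`_i * mu i.
Proof.
move=> fn; rewrite /moment (big_ord_widen n (fun i => f`_i * mu i) fn).
rewrite big_mkcond; apply: eq_bigr => i _; case: ltnP => // /leq_sizeP-> //.
by rewrite mul0r.
Qed.

Lemma moment_is_linear : linear_for *%R moment.
Proof.
move=> a f g; pose n := maxn (size f) (size g).
have fn : (size f <= n)%N by rewrite leq_maxl.
have gn : (size g <= n)%N by rewrite leq_maxr.
rewrite (moment_widen fn) (moment_widen gn) (@moment_widen n).
  rewrite mulr_sumr -big_split /=; apply: eq_bigr => i _.
  by rewrite coefD coefZ; ring.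
rewrite (leq_trans (size_polyD _ _)) // geq_max gn andbT.
exact: leq_trans (size_scale_leq _ _) fn.
Qed.

HB.instance Definition _ :=
  GRing.isLinear.Build R {poly R} R *%R moment moment_is_linear.

Lemma momentXn i : moment 'X^i = mu i.
Proof.
rewrite (@moment_widen i.+1) ?size_polyXn // big_ord_recr /= big1 ?add0r.
  by rewrite coefXn eqxx mul1r.
by move=> j _; rewrite coefXn ltn_eqF ?mul0r.
Qed.

Definition wronskian_form f g : R := moment (f * g^`() - f^`() * g).

Lemma wronskian_formC f g : wronskian_form g f = - wronskian_form f g.
Proof.
by rewrite /wronskian_form -[RHS]raddfN /= opprB ![_ * f]mulrC ![_ * f^`()]mulrC.
Qed.

Lemma wronskian_form_is_linear f : linear_for *%R (wronskian_form f).
Proof.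
move=> a g h; rewrite /wronskian_form -linearP /=; congr moment.
by rewrite derivD derivZ -!mul_polyC; ring.
Qed.

HB.instance Definition _ f := GRing.isLinear.Build R {poly R} R *%R
  (wronskian_form f) (wronskian_form_is_linear f).

Lemma wronskian_form_sum n f g :
    (size f <= n)%N -> (size g <= n)%N ->
  wronskian_form f g =
  \sum_(k < n) \sum_(l < n) f`_k * g`_l * wronskian_form 'X^k 'X^l.
Proof.
have E (h : {poly R}) : (size h <= n)%N -> h = \sum_(k < n) h`_k *: 'X^k.
  move=> hn; rewrite -poly_def; apply/polyP => j; rewrite coef_poly.
  by case: ltnP => // nj; rewrite nth_default // (leq_trans hn).
(* The form was made linear in its second argument only; antisymmetry turns the expansion of [f]
   into one on that side. *)
move=> /E fE /E gE; rewrite wronskian_formC [X in wronskian_form _ X]fE.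
rewrite linear_sum -sumrN; apply: eq_bigr => k _.
rewrite linearZ /= -mulrN -wronskian_formC [X in wronskian_form _ X]gE.
rewrite linear_sum mulr_sumr; apply: eq_bigr => l _.
by rewrite linearZ /= mulrA.
Qed.

(** The truncated predecessor matters only at [k = l = 0], where the factor [l - k] vanishes. *)
Lemma wronskian_formXn k l :
  wronskian_form 'X^k 'X^l = (l%:R - k%:R) * mu (k + l).-1.
Proof.
rewrite /wronskian_form !derivXn mulrnAr mulrnAl raddfB /=.
rewrite ![moment (_ *+ _)]raddfMn /=.
rewrite -!exprD !momentXn. rewrite mulrBl !mulr_natl.
case: k l => [|k] [|l]; rewrite ?mulr0n ?subr0 ?sub0r //= ?addn0 ?add0n //.
by rewrite addnS.
Qed.

End Moments.

(** * Shifted Chebyshev polynomials and their derivatives *)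

Section ShiftedChebyshev.
Variables (R : comNzRingType) (c x : R).

Fixpoint chebU n : {poly R} :=
  match n with
  | 0%N => 1
  | n1.+1 => match n1 with
             | 0%N => 'X - c%:P
             | n2.+1 => ('X - c%:P) * chebU n1 - x *: chebU n2
             end
  end.

(** With [y = (t - c) / (2 sqrt x)], [chebU n] is [x^(n/2)] times the classical second-kind
    polynomial in [y], and for [n > 0] [chebT n] is [2 x^(n/2)] times the first-kind one. At [n = 0]
    the value is [1], not [2]. *)
Definition chebT n : {poly R} :=
  if n is n1.+2 then chebU n - x *: chebU n1 else chebU n.

Lemma chebU0 : chebU 0 = 1. Proof. by []. Qed.

Lemma chebU1 : chebU 1 = 'X - c%:P. Proof. by []. Qed.

Lemma chebUSS n : chebU n.+2 = ('X - c%:P) * chebU n.+1 - x *: chebU n.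
Proof. by []. Qed.

Lemma chebUS_rec n : ('X - c%:P) * chebU n.+1 = chebU n.+2 + x *: chebU n.
Proof. by rewrite chebUSS subrK. Qed.

(** Monic of degree [n]. The recurrence looks back two steps, so two consecutive indices are carried
    through the induction. *)
Lemma coef_chebU n :
  (chebU n)`_n = 1 /\ forall j, (n < j)%N -> (chebU n)`_j = 0.
Proof.
have [] // : ((chebU n)`_n = 1 /\ forall j, (n < j)%N -> (chebU n)`_j = 0) /\
  ((chebU n.+1)`_n.+1 = 1 /\ forall j, (n.+1 < j)%N -> (chebU n.+1)`_j = 0).
elim: n => [|n [[IHa IHb] [IHc IHd]]].
  split; split; rewrite ?coef1 ?coefB ?coefX ?coefC ?subr0 //.
    by case=> // j; rewrite coef1.
  by case=> [|[|j]] // _; rewrite coefB coefX coefC subr0.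
split=> //; rewrite chebUSS mulrBl.
split=> [|j nj]; rewrite !coefB coefXM coefCM coefZ.
  by rewrite /= IHc IHd // IHb // !mulr0 !subr0.
case: j nj => // j nj; rewrite /= IHd // IHd ?(ltnW nj) // IHb ?mulr0 ?subr0 //.
by rewrite -ltnS; apply: ltn_trans nj; rewrite ltnS.
Qed.

(** This is the classical rule that [chebT] of index [n + 2] has derivative [(n + 2) U_{n+1}],
    arranged as a recursion for the derivatives of the [U]. *)
Lemma deriv_chebUSS n :
  (chebU n.+2)^`() = n.+2%:R *: chebU n.+1 + x *: (chebU n)^`().
Proof.
have [] // : (chebU n.+2)^`() = n.+2%:R *: chebU n.+1 + x *: (chebU n)^`() /\
  (chebU n.+3)^`() = n.+3%:R *: chebU n.+2 + x *: (chebU n.+1)^`().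
have dS k : (chebU k.+2)^`() =
    chebU k.+1 + ('X - c%:P) * (chebU k.+1)^`() - x *: (chebU k)^`().
  by rewrite chebUSS derivB derivM derivZ derivB derivX derivC subr0 mul1r.
have U1' : (chebU 1)^`() = 1 by rewrite chebU1 derivB derivX derivC subr0.
have U0' : (chebU 0)^`() = 0 by rewrite chebU0 derivC.
have U2' : (chebU 2)^`() = 2%:R *: chebU 1 + x *: (chebU 0)^`().
  by rewrite dS U0' U1' chebU1 !scaler0 scaler_nat; ring.
elim: n => [|n [IH1 IH2]]; split=> //; rewrite [LHS]dS.
  rewrite U2' U0' U1' chebUSS chebU0 scaler0 addr0 -!mul_polyC !polyCD; ring.
rewrite [in LHS]IH2 [in LHS]IH1 dS (chebUSS n.+1) -!mul_polyC !rmorph_nat; ring.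
Qed.

End ShiftedChebyshev.

Arguments chebU {R} c x n : simpl never.

(** * Orthogonality and values of the alternating form *)

Section Orthogonality.
Variables (R : comNzRingType) (c x : R) (a : nat -> nat -> R).
(* [a m k] is the coefficient of [U k] in the expansion of ['X^m]. *)
Hypothesis a0 : forall k, a 0 k = (k == 0%N)%:R.
Hypothesis aS0 : forall m, a m.+1 0 = c * a m 0 + x * a m 1.
Hypothesis aSS : forall m k,
  a m.+1 k.+1 = a m k + c * a m k.+1 + x * a m k.+2.

Local Notation mom := (moment (fun m => a m 0)).
Local Notation W := (wronskian_form (fun m => a m 0)).
Local Notation U := (chebU c x).
Local Notation T := (chebT c x).

(** The hypotheses on [a] express multiplication by ['X] in the basis [U]. The value is the one
    forced by orthogonality with squared norms [x ^+ k]. *)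
Lemma moment_chebUXn k m : mom (U k * 'X^m) = x ^+ k * a m k.
Proof.
have [] // : (forall m, mom (U k * 'X^m) = x ^+ k * a m k) /\
             (forall m, mom (U k.+1 * 'X^m) = x ^+ k.+1 * a m k.+1).
elim: k {m} => [|k [IH1 IH2]]; split=> // m.
- by rewrite mul1r momentXn mul1r.
- by rewrite chebU1 mulrBl -exprS mul_polyC linearB linearZ /= !momentXn aS0; ring.
- rewrite chebUSS mulrBl -scalerAl linearB linearZ /=.
  rewrite (_ : _ * _ * 'X^m = U k.+1 * 'X^(m.+1) - c *: (U k.+1 * 'X^m)).
    by rewrite linearB linearZ /= !IH2 IH1 aSS !exprS; ring.
  by rewrite exprS -mul_polyC; ring.
Qed.

Lemma moment_chebU k : mom (U k) = (k == 0%N)%:R.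
Proof.
rewrite -[U k]mulr1 -(expr0 'X) moment_chebUXn a0.
by case: k => [|k]; rewrite ?mulr0 ?mulr1.
Qed.

Lemma moment_chebUM i j : mom (U i * U j) = (i == j)%:R * x ^+ i.
Proof.
(* Both identities move the factor ['X - c%:P] from one polynomial to the other and apply the
   recurrence on each side. *)
have shift k l : mom (U k.+2 * U l.+1) = mom (U k.+1 * U l.+2) +
    x * mom (U k.+1 * U l) - x * mom (U k * U l.+1).
  rewrite -!linearZ -linearD -linearB /=; congr moment.
  by rewrite !chebUSS -!mul_polyC; ring.
have shift0 k : mom (U k.+2 * U 0) = mom (U k.+1 * U 1) - x * mom (U k * U 0).
  rewrite -!linearZ -linearB /=; congr moment.
  by rewrite !chebUSS chebU1 -!mul_polyC; ring.
have [] // : (forall j, mom (U i * U j) = (i == j)%:R * x ^+ i) /\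
             (forall j, mom (U i.+1 * U j) = (i.+1 == j)%:R * x ^+ i.+1).
elim: i {j} => [|i [IH1 IH2]]; split=> //.
- by move=> j; rewrite mul1r moment_chebU mulr1 eq_sym.
- case=> [|j]; first by rewrite mulr1 moment_chebU mul0r.
  rewrite chebU1 chebUS_rec linearD linearZ /= !moment_chebU add0r expr1.
  by rewrite mulrC eqSS eq_sym.
- case=> [|j].
    rewrite shift0 IH1 IH2 !eqSS mul0r eq_sym; case: eqP => [<-|_].
      by rewrite expr0 expr1; ring.
    by rewrite !mul0r mulr0 subr0.
  rewrite shift !IH1 !IH2 !eqSS [x ^+ i.+2]exprS [x ^+ i.+1]exprS; ring.
Qed.

Definition chebU_deriv_moment i j := mom (U i * (U j)^`()).
Local Notation D := chebU_deriv_moment.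

Lemma chebU_deriv_moment0 i : D i 0 = 0.
Proof. by rewrite /D chebU0 derivC mulr0 raddf0. Qed.

Lemma chebU_deriv_moment1 i : D i 1 = (i == 0%N)%:R.
Proof.
by rewrite /D chebU1 derivB derivX derivC subr0 mulr1 moment_chebU.
Qed.

(** The derivative rule combined with orthogonality gives a recursion of step two in [j]; parity and
    degree vanishing both follow from it. *)
Lemma chebU_deriv_momentSS i j :
  D i j.+2 = (i == j.+1)%:R * (j.+2%:R * x ^+ i) + x * D i j.
Proof.
rewrite /D deriv_chebUSS mulrDr -!scalerAr linearD !linearZ /= moment_chebUM.
by ring.
Qed.

Lemma chebU_deriv_moment_parity i j : odd i = odd j -> D i j = 0.
Proof.
have [m] := ubnP j; elim: m j => // m IH [|[|j]] jm oij.
- exact: chebU_deriv_moment0.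
- by rewrite chebU_deriv_moment1; case: (i) oij.
- rewrite chebU_deriv_momentSS (IH j) ?mulr0 ?addr0; first last.
  + by rewrite oij /= negbK.
  + exact: ltnW jm.
  by case: eqP oij => [-> /=|_ _]; rewrite ?mul0r //; case: odd.
Qed.

(** The derivative of [U j] has degree below [j], hence is orthogonal to [U i]. *)
Lemma chebU_deriv_moment_le i j : (j <= i)%N -> D i j = 0.
Proof.
have [m] := ubnP j; elim: m j => // m IH [|[|j]] jm ji.
- exact: chebU_deriv_moment0.
- by rewrite chebU_deriv_moment1; case: (i) ji.
- by rewrite chebU_deriv_momentSS gtn_eqF // mul0r (IH j) ?mulr0 ?add0r //; lia.
Qed.

Lemma chebU_deriv_moment_next i : D i i.+1 = i.+1%:R * x ^+ i.
Proof.
case: i => [|i]; first by rewrite chebU_deriv_moment1 mulr1.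
rewrite chebU_deriv_momentSS eqxx mul1r.
by rewrite (@chebU_deriv_moment_le i.+1 i) ?mulr0 ?addr0.
Qed.

Lemma wronskian_chebU i j : W (U i) (U j) = D i j - D j i.
Proof. by rewrite /wronskian_form linearB [(U i)^`() * _]mulrC. Qed.

Lemma wronskian_chebU_parity i j : odd i = odd j -> W (U i) (U j) = 0.
Proof. by move=> o; rewrite wronskian_chebU !chebU_deriv_moment_parity ?subr0. Qed.

Lemma wronskian_chebUT_parity i j : odd i = odd j -> W (U i) (T j) = 0.
Proof.
case: j => [|[|j]] o; rewrite ?wronskian_chebU_parity //= linearB linearZ /=.
by rewrite !wronskian_chebU_parity ?mulr0 ?subr0 // o /= negbK.
Qed.

Lemma wronskian_chebT_parity i j : odd i = odd j -> W (T i) (T j) = 0.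
Proof.
rewrite wronskian_formC; case: i => [|[|i]] o.
- by rewrite wronskian_formC opprK wronskian_chebUT_parity.
- by rewrite wronskian_formC opprK wronskian_chebUT_parity.
rewrite linearB linearZ /= !(wronskian_formC _ (U _)).
by rewrite !wronskian_chebUT_parity ?(oppr0, mulr0, subr0) // -o /= negbK.
Qed.

(** The derivative of [T j] is [j U_{j-1}], orthogonal to [U i] since [i < j - 1]. The derivative of
    [U i] has degree below [j - 2], hence is orthogonal to both terms of [T j]. *)
Lemma wronskian_chebUT_lt i j : (i.+1 < j)%N -> W (U i) (T j) = 0.
Proof.
case: j => [|[|j]] //= ij; rewrite linearB linearZ /= !wronskian_chebU.
rewrite chebU_deriv_momentSS ltn_eqF 1?ltnS //.
rewrite (@chebU_deriv_moment_le j.+2) ?(@chebU_deriv_moment_le j); try lia.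
by rewrite mul0r; ring.
Qed.

(** The derivative of [T i.+1] contributes [(i + 1) x^i] and that of [U i] contributes [i x^i],
    through the term [- x U_{i-1}] of [T i.+1]. *)
Lemma wronskian_chebUT_next i : W (U i) (T i.+1) = (i.*2.+1)%:R * x ^+ i.
Proof.
case: i => [|i] /=.
  by rewrite wronskian_chebU chebU_deriv_moment0 chebU_deriv_moment1 subr0 mulr1.
rewrite linearB linearZ /= !wronskian_chebU !chebU_deriv_moment_next.
rewrite !chebU_deriv_moment_le; try lia.
have -> : (i.+1.*2.+1)%:R = i.+2%:R + i.+1%:R :> R.
  by rewrite -natrD; congr _%:R; lia.
by rewrite exprS; ring.
Qed.

End Orthogonality.

Definition skew_basis (R : comNzRingType) (c x : R) k : {poly R} :=
  if odd k then chebT c x k else chebU c x k.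

Lemma coef_skew_basis (R : comNzRingType) (c x : R) k :
  (skew_basis c x k)`_k = 1 /\
  forall j, (k < j)%N -> (skew_basis c x k)`_j = 0.
Proof.
rewrite /skew_basis; case: ifP => _; last exact: coef_chebU.
case: k => [|[|k]]; try exact: coef_chebU.
have [c1 c2] := coef_chebU c x k.+2; have [_ c3] := coef_chebU c x k.
split=> [|j kj]; rewrite coefB coefZ ?c1 ?c2 ?c3 ?mulr0 ?subr0 //; lia.
Qed.

(** * Narayana polynomials as moments *)

(** The coefficient of [t^d] in [(1 + t)^m (1 + x/t)^m = (1 + x + t + x/t)^m]: walks of length [m]
    from [0] to [d] with up-steps of weight [1], down-steps [x] and level steps [1 + x]. *)
Definition bin_corr m d : {poly rat} :=
  \poly_(j < m.+1) ('C(m, j) * 'C(m, j + d))%:R.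

Lemma coef_bin_corr m d j : (bin_corr m d)`_j = ('C(m, j) * 'C(m, j + d))%:R.
Proof. by rewrite coef_poly ltnS; case: leqP => // /bin_small->. Qed.

Lemma bin_corrS0 m :
  bin_corr m.+1 0 = (1 + 'X) * bin_corr m 0 + 'X * bin_corr m 1 *+ 2.
Proof.
apply/polyP => -[|j].
  rewrite mulrDl mul1r !(coefD, coefMn, coefXM, coef_bin_corr) /=.
  by rewrite !bin0 !addr0.
rewrite mulrDl mul1r !(coefD, coefMn, coefXM, coef_bin_corr) /= !addn0 addn1.
by rewrite binS !(natrM, natrD); ring.
Qed.

Lemma bin_corrSS m d :
  bin_corr m.+1 d.+1 =
  (1 + 'X) * bin_corr m d.+1 + bin_corr m d + 'X * bin_corr m d.+2.
Proof.
apply/polyP => -[|j].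
  rewrite mulrDl mul1r !(coefD, coefXM, coef_bin_corr) /= !add0n !bin0 binS.
  by rewrite !(natrM, natrD); ring.
rewrite mulrDl mul1r !(coefD, coefXM, coef_bin_corr) /= !addnS !addSn.
by rewrite !binS !(natrM, natrD); ring.
Qed.

(** The reflection principle: the subtracted term removes the walks that go below [0]. *)
Definition ballot_poly m k : {poly rat} := bin_corr m k - 'X * bin_corr m k.+2.

Lemma ballot_poly0 k : ballot_poly 0 k = (k == 0%N)%:R.
Proof.
apply/polyP => j; rewrite coefB coefXM !coef_bin_corr.
case: k j => [|k] [|[|j]]; rewrite ?coef1 ?coef0 /= ?bin0n ?bin_small ?muln0;
by rewrite ?subr0.
Qed.

Lemma ballot_polyS0 m :
  ballot_poly m.+1 0 = (1 + 'X) * ballot_poly m 0 + 'X * ballot_poly m 1.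
Proof. by rewrite /ballot_poly bin_corrS0 bin_corrSS; ring. Qed.

Lemma ballot_polySS m k :
  ballot_poly m.+1 k.+1 =
  ballot_poly m k + (1 + 'X) * ballot_poly m k.+1 + 'X * ballot_poly m k.+2.
Proof. by rewrite /ballot_poly !bin_corrSS; ring. Qed.

(** The two-by-two determinant formula for Narayana numbers. For [j < m] every binomial is a
    rational multiple of ['C(m, j.+1)], which leaves an identity of rational functions. *)
Lemma narayana_coef m j :
  (m.+1%:R^-1 * 'C(m.+1, j.+2)%:R * 'C(m.+1, j.+1)%:R : rat) =
  'C(m, j.+1)%:R * 'C(m, j.+1)%:R - 'C(m, j)%:R * 'C(m, j.+2)%:R.
Proof.
have [mj | jm] := leqP m j.
  rewrite (@bin_small m j.+1) // (@bin_small m j.+2) 1?ltnW //.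
  by rewrite (@bin_small m.+1 j.+2) //; ring.
have [p ->] : exists p, m = (j + p).+1 by exists (m - j.+1 )%N; lia.
have eA : j.+1%:R * 'C((j + p).+1, j.+1)%:R = p.+1%:R * 'C((j + p).+1, j)%:R :> rat.
  by rewrite -!natrM mul_bin_left; congr ((_ * _)%N%:R); lia.
have eD : j.+2%:R * 'C((j + p).+1, j.+2)%:R = p%:R * 'C((j + p).+1, j.+1)%:R :> rat.
  by rewrite -!natrM mul_bin_left; congr ((_ * _)%N%:R); lia.
have p0 : 0 <= p%:R :> rat by exact: ler0n.
have j0 : 0 <= j%:R :> rat by exact: ler0n.
have pz : p.+1%:R != 0 :> rat by rewrite pnatr_eq0.
have jz : j.+2%:R != 0 :> rat by rewrite pnatr_eq0.
have binSR k : 'C((j + p).+2, k.+1)%:R =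
    'C((j + p).+1, k.+1)%:R + 'C((j + p).+1, k)%:R :> rat by rewrite -natrD.
rewrite !binSR.
have -> : 'C((j + p).+1, j.+2)%:R =
    p%:R / j.+2%:R * 'C((j + p).+1, j.+1)%:R :> rat.
  by apply: (mulfI jz); rewrite eD; field; apply: lt0r_neq0; lra.
have -> : 'C((j + p).+1, j)%:R =
    j.+1%:R / p.+1%:R * 'C((j + p).+1, j.+1)%:R :> rat.
  by apply: (mulfI pz); rewrite -eA; field; apply: lt0r_neq0; lra.
move: ('C((j + p).+1, j.+1)%:R : rat) => B; field.
by apply/and3P; split; apply: lt0r_neq0; lra.
Qed.

Lemma narayanaS m : narayana m.+1 = 'X * ballot_poly m 0.
Proof.
rewrite /narayana /= big_mkord.
rewrite -(poly_def _ (fun k =>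
  m.+1%:R^-1 * 'C(m.+1, k)%:R * (bin_pred m.+1 k)%:R : rat)); apply/polyP => -[|j].
  by rewrite coef_poly coefXM /= mulr0.
rewrite coef_poly coefXM coefB coefXM !coef_bin_corr /= addn0 ltnS.
case: j => [|j].
  by rewrite !bin0 bin1 subr0 mulr1 mulVf // pnatr_eq0.
rewrite narayana_coef ?addn0 ?addn2 -!natrM; case: ltnP => // mj.
by rewrite (@bin_small m j.+1) // (@bin_small m j.+2) 1?ltnW // ?muln0 subrr.
Qed.

(** * Evaluation of the Pfaffian *)

Lemma det_skew_basis (R : comNzRingType) (c x : R) n :
  \det (\matrix_(k < n, l < n) (skew_basis c x k)`_l) = 1.
Proof.
rewrite det_trig.
  by rewrite big1 // => i _; rewrite mxE; case: (coef_skew_basis c x i).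
apply/is_trig_mxP => i j ij; rewrite mxE.
by case: (coef_skew_basis c x i) => _; apply.
Qed.

Lemma size_skew_basis (R : comNzRingType) (c x : R) n (k : 'I_n) :
  (size (skew_basis c x k) <= n)%N.
Proof.
apply/leq_sizeP => j nj; have [_] := coef_skew_basis c x k; apply.
exact: leq_trans (ltn_ord k) nj.
Qed.

Theorem theorem4 (n : nat) :
  pfaffian (narayana_mx n) = 'X^(n ^ 2) * \prod_(0 <= k < n) (4 * k + 1)%:R.
Proof.
pose W := wronskian_form (fun m => ballot_poly m 0).
pose q := skew_basis (1 + 'X) ('X : {poly rat}).
pose B := \matrix_(k < n.*2, l < n.*2) (q k)`_l.
pose c := #|[pred s : 'S_n.*2 | blocks s == blocks 1]|.
have detB : \det B = 1 by exact: det_skew_basis.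
have skN k l : narayana_mx n l k = - narayana_mx n k l.
  by rewrite !mxE addnC; ring.
have NW (k l : 'I_n.*2) : narayana_mx n k l = 'X * W 'X^k 'X^l.
  rewrite mxE /W wronskian_formXn mulrCA.
  (* [narayana 0] is not divisible by ['X], but it occurs only where [l - k] is zero. *)
  case kl: (k + l)%N => [|m]; last by rewrite narayanaS.
  have [-> ->] : (k : nat) = 0%N /\ (l : nat) = 0%N by lia.
  by rewrite subrr !mul0r.
(* The rows of [B] hold the coefficients of the basis [q], so the congruence gives the Gram matrix
   in that basis. *)
have AW k l : (B *m narayana_mx n *m B^T) k l = 'X * W (q k) (q l).
  rewrite /W /q (wronskian_form_sum _ (size_skew_basis _ _ k)
    (size_skew_basis _ _ l)).
  rewrite !mxE mulr_sumr; under [RHS]eq_bigr => i _ do rewrite mulr_sumr.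
  rewrite exchange_big; apply: eq_bigr => j _; rewrite !mxE mulr_suml.
  by apply: eq_bigr => i _; rewrite NW [B _ _]mxE /W /q; ring.
have pfc : pfaffian (narayana_mx n) *+ c =
           (\prod_(i < n) ('X * W (q (ord_fst i)) (q (ord_snd i)))) *+ c.
  rewrite -pf_sum_pfaffian // -[LHS]mul1r -[X in X * _]detB -pf_sum_congr.
  rewrite pf_sum_triangular.
  - by congr (_ *+ _); apply: eq_bigr => i _; rewrite AW.
  - by move=> k l; rewrite !AW [W (q l) _]wronskian_formC mulrN.
  - move=> k l o; rewrite AW /q /skew_basis -o.
    case: ifP => _; rewrite /W.
      by rewrite (wronskian_chebT_parity ballot_poly0 ballot_polyS0 ballot_polySS) ?mulr0.
    by rewrite (wronskian_chebU_parity ballot_poly0 ballot_polyS0 ballot_polySS) ?mulr0.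
  - move=> i j ij; rewrite AW /q /skew_basis odd_ord_fst odd_ord_snd.
    rewrite /W (wronskian_chebUT_lt ballot_poly0 ballot_polyS0 ballot_polySS)
      ?mulr0 //=; lia.
have c0 : (0 < c)%N by apply/card_gt0P; exists 1%g; rewrite inE.
(* The multiplicity [c] cancels because [{poly rat}] is an integral domain of characteristic
   zero. *)
have {pfc c0} -> : pfaffian (narayana_mx n) =
    \prod_(i < n) ('X * W (q (ord_fst i)) (q (ord_snd i))).
  have nzc : c%:R != 0 :> {poly rat}.
    by rewrite -polyC_natr polyC_eq0 pnatr_eq0 -lt0n.
  by apply: (mulIf nzc); rewrite !mulr_natr.
(* Factor [i] is [(4i + 1) 'X^(2i + 1)], and the first [n] odd numbers add up to [n ^ 2]. *)
rewrite big_mkord (_ : (n ^ 2)%N = \sum_(i < n) i.*2.+1)%N.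
  rewrite -prodrXr -big_split; apply: eq_bigr => i _ /=.
  rewrite /W /q /skew_basis odd_ord_fst odd_ord_snd.
  rewrite (wronskian_chebUT_next ballot_poly0 ballot_polyS0 ballot_polySS) /=.
  rewrite mulrCA -exprS mulrC; congr (_ * _%:R); lia.
elim: n {W q B c detB skN NW AW} => [|n IH]; first by rewrite big_ord0.
rewrite big_ord_recr /= -IH; lia.
Qed.
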